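(* Let $E$ be a modular Archimedean atomic lattice effect algebra with $S(E)\neq E$, where $S(E)=\{x\in E\mid x\wedge x'=0\}$ is the set of sharp elements of $E$. Then there exists an $(o)$-continuous state $\omega$ on $E$ which is subadditive.
   Context: An effect algebra $(E;\oplus,0,1)$ is a set $E$ with two distinct elements $0,1$ and a partially defined binary operation $\oplus$ such that for all $x,y,z\in E$: (Ei) $x\oplus y=y\oplus x$ if $x\oplus y$ is defined; (Eii) $(x\oplus y)\oplus z=x\oplus(y\oplus z)$ if one side is defined; (Eiii) for every $x$ there is a unique $y$, denoted $x'$, with $x\oplus y=1$; (Eiv) if $1\oplus x$ is defined then $x=0$. The partial order is: $x\le y$ iff there is $z$ with $x\oplus z$ defined and $x\oplus z=y$; then $y\ominus x:=z$. $E$ is a lattice effect algebra if $(E,\le)$ is a lattice, and modular if moreover this lattice is modular. An atom is a minimal nonzero element; $E$ is atomic if below every nonzero element there is an atom. $E$ is Archimedean if for every $x\in E$, $x\neq 0$, there is a greatest positive integer $n$ such that $nx=x\oplus\cdots\oplus x$ ($n$ times) exists. A state on $E$ is a map $\omega:E\to[0,1]\subseteq\mathbb{R}$ with $\omega(0)=0$, $\omega(1)=1$ and $\omega(x\oplus y)=\omega(x)+\omega(y)$ whenever $x\oplus y$ exists. It is subadditive if $\omega(x\vee y)\le\omega(x)+\omega(y)$ for all $x,y\in E$. For a net $(x_\alpha)$ indexed by a directed set, $x_\alpha\uparrow x$ means the net is increasing with $x=\bigvee_\alpha x_\alpha$ in $E$, and $x_\alpha\downarrow x$ is dual; the net order converges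 to $x$ if there are nets $(u_\alpha),(v_\alpha)$ over the same directed set with $u_\alpha\uparrow x$, $v_\alpha\downarrow x$ and $u_\alpha\le x_\alpha\le v_\alpha$ for all $\alpha$. A state $\omega$ is $(o)$-continuous if $\omega(x_\alpha)\to\omega(x)$ whenever the net $(x_\alpha)$ order converges to $x$ (equivalently, $x_\alpha\uparrow x$ implies $\omega(x_\alpha)\uparrow\omega(x)$). *)

(* Defs.v *)
From HB Require Import structures.
From mathcomp Require Import all_boot all_order all_algebra.
From mathcomp Require Import boolp classical_sets reals filter topology.
From mathcomp Require Import normedtype.
Set Implicit Arguments.
Unset Strict Implicit.
Unset Printing Implicit Defensive.
Import Order.TTheory GRing.Theory Num.Theory numFieldNormedType.Exports.

Local Open Scope classical_set_scope.
Local Open Scope order_scope.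

(* [osum x y = None] means that the orthogonal sum of x and y is undefined.
   Equations between options say that each side is defined iff the other one
   is, in which case both values agree.  Carriers are choice types only to fit
   the algebraic hierarchy: classically every type is one (see {classic T}). *)
HB.mixin Record isEffectAlgebra T of Choice T := {
  ea0 : T;
  ea1 : T;
  osum : T -> T -> option T;
  ea0_neq1 : ea0 <> ea1;
  osumC : forall x y, osum x y = osum y x;
  osumA : forall x y z,
    obind (fun xy => osum xy z) (osum x y) =
    obind (fun yz => osum x yz) (osum y z);
  osum_ortho : forall x, exists! y, osum x y = Some ea1;
  osum1_eq0 : forall x, osum ea1 x -> x = ea0
}.

#[short(type="effectAlgebraType")]
HB.structure Definition EffectAlgebra := {T of Choice T & isEffectAlgebra T}.

Definition ea_le (E : effectAlgebraType) (x y : E) : Prop :=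
  exists z, osum x z = Some y.

Definition ortho (E : effectAlgebraType) (x : E) : E :=
  projT1 (cid (osum_ortho x)).

Definition ea_mul (E : effectAlgebraType) (n : nat) (x : E) : option E :=
  iter n (obind (osum x)) (Some ea0).

Definition ea_archimedean (E : effectAlgebraType) : Prop :=
  forall x : E, x <> ea0 -> exists n : nat,
    [/\ (0 < n)%N, ea_mul n x & forall m : nat, ea_mul m x -> (m <= n)%N].

HB.mixin Record isLatticeEffectAlgebra (d : Order.disp_t) T
    of Order.Lattice d T & EffectAlgebra T := {
  le_eaP : forall x y : T, (x <= y) <-> ea_le x y
}.

#[short(type="latticeEffectAlgebraType")]
HB.structure Definition LatticeEffectAlgebra (d : Order.disp_t) :=
  {T of Order.Lattice d T & EffectAlgebra T & isLatticeEffectAlgebra d T}.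

Section LatticeEffectAlgebras.
Context {d : Order.disp_t}.
Implicit Type E : latticeEffectAlgebraType d.

Definition ea_modular E : Prop :=
  forall x y z : E, x <= z -> x `|` (y `&` z) = (x `|` y) `&` z.

Definition ea_atom E (a : E) : Prop :=
  a <> ea0 /\ forall b : E, b <> ea0 -> b <= a -> b = a.

Definition ea_atomic E : Prop :=
  forall x : E, x <> ea0 -> exists2 a, ea_atom a & a <= x.

Definition sharp E : set E := [set x | x `&` ortho x = ea0].

End LatticeEffectAlgebras.

Record directed (D : Type) (leD : D -> D -> Prop) : Prop := {
  directed_inhabited : inhabited D;
  directed_refl : forall a, leD a a;
  directed_trans : forall a b c, leD a b -> leD b c -> leD a c;
  directed_ub : forall a b, exists c, leD a c /\ leD b c
}.

Definition tails (D : Type) (leD : D -> D -> Prop) : set_system D :=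
  filter_from setT (fun a => [set b | leD a b]).

Section OrderConvergence.
Context {d : Order.disp_t} {E : latticeEffectAlgebraType d}.
Context {D : Type} (leD : D -> D -> Prop).
Implicit Types (u : D -> E) (x : E).

Definition net_up u x : Prop :=
  (forall a b, leD a b -> u a <= u b) /\ supremums (range u) x.

Definition net_down u x : Prop :=
  (forall a b, leD a b -> u b <= u a) /\ infimums (range u) x.

Definition order_converges u x : Prop :=
  exists l r : D -> E,
    [/\ net_up l x, net_down r x & forall a, l a <= u a /\ u a <= r a].

End OrderConvergence.

Section States.
Context {R : realType} {d : Order.disp_t} {E : latticeEffectAlgebraType d}.
Implicit Type w : E -> R.
Local Open Scope ring_scope.

Record is_state w : Prop := {
  state_itv : forall x, 0 <= w x /\ w x <= 1;
  state0 : w ea0 = 0;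
  state1 : w ea1 = 1;
  state_osum : forall x y z, osum x y = Some z -> w z = w x + w y
}.

Definition subadditive_state w : Prop :=
  forall x y : E, w (Order.join x y) <= w x + w y.

Definition o_continuous w : Prop :=
  forall (D : Type) (leD : D -> D -> Prop), directed leD ->
  forall (u : D -> E) (x : E), order_converges leD u x ->
  w (u a) @[a --> tails leD] --> w x.

End States.

(* Main.v *)
(** A non-sharp element gives an atom [a] with [a] orthogonal to itself.  If
every atom is orthogonal to [a], put [u = n a] with [n] the order of [a]: then
[0, u] is the chain of multiples of [a].  Otherwise let [b] be an atom not
orthogonal to [a]; modularity forces [a \/ b = 2 a], and [0, u] has height 2
for [u = 2 a].  In both cases [u] is sharp and every atom lies below [u] or
below [u'], which makes [u] central.  The state sends [x] to the height of
[x /\ u] divided by the height of [u]; having finitely many values, it is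
eventually constant along monotone nets, hence (o)-continuous. *)
From mathcomp Require Import all_boot all_order all_algebra.
From mathcomp Require Import boolp classical_sets reals.
From mathcomp Require Import filter topology normedtype.
Require Import Defs.
Set Implicit Arguments.
Unset Strict Implicit.
Unset Printing Implicit Defensive.
Import Order.TTheory GRing.Theory Num.Theory numFieldNormedType.Exports.

Local Open Scope order_scope.

(** * Cancellation and orthosupplements in effect algebras *)

Section EffectAlgebraTheory.
Context {E : effectAlgebraType}.
Implicit Types x y z r s t : E.

(** Associativity in relational form, which names the intermediate sums; [osumA_l] is the other
    direction. *)
Lemma osumA_r x y s z t : osum x y = Some s -> osum s z = Some t ->
  exists2 r, osum y z = Some r & osum x r = Some t.
Proof.
move=> xy sz; have := osumA x y z; rewrite xy /= sz.
by case: (osum y z) => //= r xr; exists r.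
Qed.

Lemma osumA_l x y z r t : osum y z = Some r -> osum x r = Some t ->
  exists2 s, osum x y = Some s & osum s z = Some t.
Proof.
move=> yz xr; have := osumA x y z; rewrite yz /= xr.
by case: (osum x y) => //= s sz; exists s.
Qed.

Lemma osum_orthor x : osum x (ortho x) = Some ea1.
Proof. by rewrite /ortho; case: cid => y []. Qed.

Lemma orthoP x y : osum x y = Some ea1 -> ortho x = y.
Proof. by rewrite /ortho; case: cid => z [_] /= uz /uz. Qed.

Lemma orthoK x : ortho (ortho x) = x.
Proof. by apply: orthoP; rewrite osumC osum_orthor. Qed.

Lemma ortho1 : ortho (ea1 : E) = ea0.
Proof. by apply: osum1_eq0; rewrite osum_orthor. Qed.

Lemma ortho0 : ortho (ea0 : E) = ea1.
Proof. by rewrite -ortho1 orthoK. Qed.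

(** Reassociating (x' + x) + 0 = 1 shows that x + 0 is the orthosupplement of x', which is x. *)
Lemma osum0r x : osum x ea0 = Some x.
Proof.
have h : osum ea1 ea0 = Some (ea1 : E) by rewrite -ortho1 osum_orthor.
have h' : osum (ortho x) x = Some ea1 by rewrite osumC osum_orthor.
have [r -> /orthoP <-] := osumA_r h' h.
by rewrite orthoK.
Qed.

Lemma osum0l x : osum ea0 x = Some x.
Proof. by rewrite osumC osum0r. Qed.

(** Adding t' to both sums makes x + t' the orthosupplement of [y] and of [z]. *)
Lemma osum_inj x y z t : osum x y = Some t -> osum x z = Some t -> y = z.
Proof.
move=> xy xz; have tt' := osum_orthor t.
rewrite osumC in xy; rewrite osumC in xz.
have [r xr /orthoP yr] := osumA_r xy tt'.
have [r']:= osumA_r xz tt'.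
rewrite xr => -[<-] /orthoP zr.
by rewrite -(orthoK y) yr -zr orthoK.
Qed.

Lemma osum_defP x y : osum x y <-> ea_le x (ortho y).
Proof.
split=> [|[z xz]].
  case xy: (osum x y) => [t|//] _; rewrite osumC in xy.
  have [r xr /orthoP ->] := osumA_r xy (osum_orthor t).
  by exists (ortho t).
have [s + _] := osumA_l xz (osum_orthor y).
by rewrite osumC => ->.
Qed.

End EffectAlgebraTheory.

(** * Order, disjoint sums and sharp elements *)

Section LatticeEffectAlgebraTheory.
Context {d : Order.disp_t} {E : latticeEffectAlgebraType d}.
Implicit Types a b c p q r s t u x y z : E.

Lemma le_osumP x y : x <= y <-> exists z, osum x z = Some y.
Proof. exact: le_eaP. Qed.

Lemma le_osuml x y t : osum x y = Some t -> x <= t.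
Proof. by move=> xy; apply/le_osumP; exists y. Qed.

Lemma le_osumr x y t : osum x y = Some t -> y <= t.
Proof. by rewrite osumC; apply: le_osuml. Qed.

Lemma ea_le0x x : ea0 <= x.
Proof. exact: le_osuml (osum0l x). Qed.

Lemma ea_lex0 x : x <= ea0 -> x = ea0.
Proof. by move=> x0; apply/le_anti; rewrite x0 ea_le0x. Qed.

Lemma ea_lex1 x : x <= ea1.
Proof. exact: le_osuml (osum_orthor x). Qed.

Lemma osum_orthoP x y : osum x y <-> x <= ortho y.
Proof. by rewrite osum_defP; split=> /le_eaP. Qed.

Lemma osum_some x y : x <= ortho y -> exists t, osum x y = Some t.
Proof. by move/osum_orthoP; case: osum => // t; exists t. Qed.

Lemma le_ortho_sym x y : x <= ortho y -> y <= ortho x.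
Proof. by move/osum_orthoP; rewrite osumC => /osum_orthoP. Qed.

Lemma le_ortho x y : x <= y -> ortho y <= ortho x.
Proof. by move=> xy; apply: le_ortho_sym; rewrite orthoK. Qed.

Lemma ortho_meet x y : ortho (x `&` y) = ortho x `|` ortho y.
Proof.
apply/le_anti/andP; split; last by rewrite leUx !le_ortho ?leIl ?leIr.
rewrite -[leRHS]orthoK le_ortho // lexI.
by rewrite -{2}[x]orthoK -{3}[y]orthoK !le_ortho ?leUl ?leUr.
Qed.

Lemma le_osum2l x y z s t : osum x y = Some s -> osum x z = Some t ->
  s <= t -> y <= z.
Proof.
move=> xy xz /le_osumP[r sr]; have [v yv xv] := osumA_r xy sr.
by rewrite (osum_inj xz xv); apply: le_osuml yv.
Qed.

(** Let [r] be the remainder of the join in [t]. Cancelling [x] gives r <= y, cancelling [y] gives r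
    <= x, so disjointness forces r = 0. *)
Lemma osum_join x y t : osum x y = Some t -> x `&` y = ea0 -> t = x `|` y.
Proof.
move=> xy xy0.
have /le_osumP[r sr] : x `|` y <= t by rewrite leUx (le_osuml xy) (le_osumr xy).
have ry : r <= y.
  have /le_osumP[p xp] := leUl x y.
  by have [v /le_osumr pr xv] := osumA_r xp sr; rewrite (osum_inj xy xv).
have rx : r <= x.
  have /le_osumP[p yp] := leUr y x; rewrite osumC in xy.
  by have [v /le_osumr pr xv] := osumA_r yp sr; rewrite (osum_inj xy xv).
have r0 : r = ea0 by apply: ea_lex0; rewrite -xy0 lexI rx.
by move: sr; rewrite r0 osum0r => -[].
Qed.

Lemma atom_meet a x : ea_atom a -> ~ (a <= x) -> a `&` x = ea0.
Proof.
move=> [a0 amin] nax; apply: contrapT => ax0; apply: nax.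
by rewrite -(amin _ ax0 (leIl _ _)) leIr.
Qed.

Lemma atom_le_atom a b : ea_atom a -> ea_atom b -> a <= b -> a = b.
Proof. by move=> [a0 _] [_ bmin]; apply: bmin. Qed.

(** The sum of a disjoint orthogonal pair is its join, hence stays below [t]; then [y] is
    cancelled. *)
Lemma le_osubl x y t r : x `&` y = ea0 -> x <= ortho y ->
  x <= t -> y <= t -> osum y r = Some t -> x <= r.
Proof.
move=> xy0 /le_ortho_sym /osum_some[s yx] xt yt yr.
apply: (le_osum2l yx yr).
by rewrite (osum_join yx) 1?meetC// leUx yt.
Qed.

(** Sharpness makes [y] and s' disjoint, so y + s' is their join. Since [x] is orthogonal to both,
    it is orthogonal to the join, and reassociating makes x + y orthogonal to s'. *)
Lemma sharp_osum_le s x y t : sharp s -> x <= s -> y <= s ->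
  osum x y = Some t -> t <= s.
Proof.
move=> ss xs ys xy.
have ys' : y <= ortho (ortho s) by rewrite orthoK.
have [r ysr] := osum_some ys'.
have rE : r = y `|` ortho s.
  apply: (osum_join ysr); apply: ea_lex0.
  by rewrite -[leRHS]ss lexI (le_trans (leIl _ _) ys) leIr.
have xr : x <= ortho r.
  apply: le_ortho_sym; rewrite rE leUx le_ortho // andbT.
  by apply/osum_orthoP; rewrite osumC xy.
have [v xv] := osum_some xr.
have [t' ] := osumA_l ysr xv.
rewrite xy => -[<-] tv.
by rewrite -[s]orthoK; apply/osum_orthoP; rewrite tv.
Qed.

Lemma sharp_ortho s : sharp s -> sharp (ortho s).
Proof. by rewrite /sharp /= orthoK meetC. Qed.

Lemma sharp_disjoint s x y : sharp s -> x <= s -> y <= ortho s ->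
  x `&` y = ea0.
Proof. by move=> ss xs ys; apply: ea_lex0; rewrite -[leRHS]ss leI2. Qed.

End LatticeEffectAlgebraTheory.

(** Common interface of the two constructions of [u]: a faithful, additive and subadditive height on
    the interval [0, u], with [h] total so that it can be composed with the meet with [u]. *)
Record rank_function {d : Order.disp_t} {E : latticeEffectAlgebraType d}
    (u : E) (h : E -> nat) : Prop := {
  rank_gt0 : (0 < h u)%N;
  rank_osum : forall x y z : E, z <= u -> osum x y = Some z ->
    h z = (h x + h y)%N;
  rank_eq0 : forall x : E, x <= u -> h x = 0%N -> x = ea0;
  rank_join : forall x y : E, x <= u -> y <= u ->
    (h (x `|` y) <= h x + h y)%N
}.

(** * Decomposition along a sharp element that splits the atoms *)

Section CentralElement.
Context {d : Order.disp_t} {E : latticeEffectAlgebraType d}.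
Context (E_atomic : ea_atomic E) (u : E) (u_sharp : sharp u).
Context (u_atoms : forall c : E, ea_atom c -> c <= u \/ c <= ortho u).
Implicit Types c p q r s t x y z : E.

(** Such a [c] can be added to x /\ s inside [x]; the sum stays below [s] by sharpness, hence below
    x /\ s, and cancellation gives c = 0. *)
Lemma sharp_remainder_eq0 s x q t y c : sharp s -> osum (x `&` s) q = Some t ->
  osum t y = Some x -> c <= y -> c <= s -> c = ea0.
Proof.
move=> ss xq ty /le_osumP[r cr] cs; apply: ea_lex0.
have [v tc vr] := osumA_l cr ty; rewrite osumC in xq.
have [w xc qw] := osumA_r xq tc.
apply: (le_osum2l xc (osum0r _)).
rewrite lexI (sharp_osum_le ss _ cs xc) ?leIr // andbT.
exact: le_trans (le_osumr qw) (le_osuml vr).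
Qed.

(** The two components are disjoint and orthogonal, so their sum is their join, below [x]. An atom
    in the remainder would lie below [u] or u', which [sharp_remainder_eq0] excludes. *)
Lemma central_osum x : osum (x `&` u) (x `&` ortho u) = Some x.
Proof.
have xu : x `&` u <= ortho (x `&` ortho u).
  by apply: (le_trans (leIr _ _)); rewrite -{1}[u]orthoK le_ortho ?leIr.
have [t xt] := osum_some xu; rewrite xt; congr Some.
have tE : t = (x `&` u) `|` (x `&` ortho u).
  by apply: (osum_join xt); apply: sharp_disjoint u_sharp _ _; rewrite leIr.
have /le_osumP[y ty] : t <= x by rewrite tE leUx !leIl.
suff y0 : y = ea0 by move: ty; rewrite y0 osum0r => -[].
apply: contrapT => /E_atomic[c c_atom cy].
have [c0 _] := c_atom; apply: c0; case: (u_atoms c_atom) => cu.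
  exact: sharp_remainder_eq0 u_sharp xt ty cy cu.
rewrite osumC in xt.
exact: sharp_remainder_eq0 (sharp_ortho u_sharp) xt ty cy cu.
Qed.

Lemma central_join x : x = (x `&` u) `|` (x `&` ortho u).
Proof.
apply: (osum_join (central_osum x)).
by apply: sharp_disjoint u_sharp _ _; rewrite leIr.
Qed.

(** Uniqueness of the decomposition: cancelling [p] in [z] gives z /\ u' <= q, so both are equal,
    and cancelling them identifies the other components. *)
Lemma central_meet p q z : p <= u -> q <= ortho u -> osum p q = Some z ->
  z `&` u = p.
Proof.
move=> pu qu pq.
have /le_osumP[r pr] : p <= z `&` u by rewrite lexI (le_osuml pq).
have [v rv pv] := osumA_r pr (central_osum z).
have qE : q = z `&` ortho u.
  apply/le_anti; rewrite lexI (le_osumr pq) qu /=.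
  by rewrite (osum_inj pq pv); apply: le_osumr rv.
have := central_osum z; rewrite -qE osumC => qz.
by rewrite osumC in pq; rewrite (osum_inj pq qz).
Qed.

(** The four components regroup into a sum [p] below [u] and a sum [q] below u'; uniqueness then
    applies. *)
Lemma central_meet_osum x y z : osum x y = Some z ->
  osum (x `&` u) (y `&` u) = Some (z `&` u).
Proof.
move=> xy.
have [r x2y x1r] := osumA_r (central_osum x) xy.
rewrite osumC in x2y.
have [q y2x2 y1q] := osumA_r (central_osum y) x2y.
have [p xyp pq] := osumA_l y1q x1r.
rewrite xyp; congr Some; apply/esym/(central_meet _ _ pq).
  by apply: (sharp_osum_le u_sharp _ _ xyp); rewrite leIr.
by apply: (sharp_osum_le (sharp_ortho u_sharp) _ _ y2x2); rewrite leIr.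
Qed.

Lemma central_meet_join x y : (x `|` y) `&` u = (x `&` u) `|` (y `&` u).
Proof.
set p := RHS; pose q := (x `&` ortho u) `|` (y `&` ortho u).
have pu : p <= u by rewrite leUx !leIr.
have qu : q <= ortho u by rewrite leUx !leIr.
have [t pq] : exists t, osum p q = Some t.
  by apply/osum_some/(le_trans pu)/le_ortho_sym.
apply: (central_meet pu qu); rewrite pq; congr Some.
rewrite [LHS](osum_join pq); first by rewrite joinACA -!central_join.
exact: sharp_disjoint u_sharp pu qu.
Qed.

(** * The state induced by a rank function *)

Section RankState.
Context (R : realType) (h : E -> nat) (hP : rank_function u h).

Definition central_rank x : nat := h (x `&` u).
Notation H := central_rank.

Lemma central_rank_osum x y z : osum x y = Some z -> H z = (H x + H y)%N.
Proof. by move=> /central_meet_osum; apply: (rank_osum hP); rewrite leIr. Qed.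

Lemma central_rank_le x y : x <= y -> (H x <= H y)%N.
Proof. by move=> /le_osumP[z /central_rank_osum ->]; rewrite leq_addr. Qed.

Lemma central_rank0 : H ea0 = 0%N.
Proof.
have /eqP := central_rank_osum (osum0r (ea0 : E)).
by rewrite -{1}[H ea0]addn0 eqn_add2l => /eqP.
Qed.

Lemma central_rank1 : H ea1 = h u.
Proof. by rewrite /H; congr h; apply/meet_idPr/ea_lex1. Qed.

Lemma central_rank_join x y : (H (x `|` y) <= H x + H y)%N.
Proof. by rewrite /H central_meet_join (rank_join hP) ?leIr. Qed.

(** If the rank does not grow, the difference has a component in [0, u] of rank 0, which vanishes by
    faithfulness. *)
Lemma central_rank_meet_eq x y : x <= y -> (H y <= H x)%N ->
  x `&` u = y `&` u.
Proof.
move=> /le_osumP[z xz]; rewrite (central_rank_osum xz) -{2}[H x]addn0.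
rewrite leq_add2l leqn0 => /eqP /(rank_eq0 hP (leIr _ _)) z0.
by have := central_meet_osum xz; rewrite z0 osum0r => -[].
Qed.

Lemma central_rank_net_up (D : Type) (leD : D -> D -> Prop) (l : D -> E) x :
  directed leD -> net_up leD l x ->
  exists a, forall b, leD a b -> H (l b) = H x.
Proof.
move=> dD [l_incr [l_ub l_min]]; have [a1] := directed_inhabited dD.
have ubP k : `[< exists a, H (l a) = k >] -> (k <= h u)%N.
  by move=> /asboolP[a <-]; rewrite -central_rank1 central_rank_le ?ea_lex1.
have exP : exists k, `[< exists a, H (l a) = k >].
  by exists (H (l a1)); apply/asboolP; exists a1.
(* Ranks are bounded by [h u], so some index [a] attains the maximum; past [a] the components below
   [u] are constant. *)
case: (ex_maxnP exP ubP) => _ /asboolP[a <-] a_max.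
have {}a_max b : (H (l b) <= H (l a))%N.
  by apply: a_max; apply/asboolP; exists b.
exists a => b ab; apply/eqP; rewrite eqn_leq central_rank_le /=; last first.
  by apply: l_ub; exists b.
suff xa : x `&` u <= l a `&` u.
  have /central_rank_le := l_incr _ _ ab; apply: leq_trans.
  have := central_rank_le xa.
  by rewrite /H -!meetA !meetxx.
(* The sum p + u' bounds the net: past [a] the component below [u] is [p], and the other one is
   below u'. So x <= p + u', whose meet with [u] is [p]. *)
pose p := l a `&` u; have pu : p <= u by rewrite leIr.
have [t pt] : exists t, osum p (ortho u) = Some t.
  by apply: osum_some; rewrite orthoK.
rewrite -/p -(central_meet pu (lexx _) pt) leI2 // l_min // => _ [c _ <-].
have [e [ce ae]] := directed_ub dD c a.
apply: (le_trans (l_incr _ _ ce)); rewrite [l e]central_join.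
rewrite -(central_rank_meet_eq (l_incr _ _ ae)) // leUx (le_osuml pt) /=.
exact: le_trans (leIr _ _) (le_osumr pt).
Qed.

Lemma central_rank_net_down (D : Type) (leD : D -> D -> Prop) (r : D -> E) x :
  directed leD -> net_down leD r x ->
  exists a, forall b, leD a b -> H (r b) = H x.
Proof.
move=> dD [r_decr [r_lb r_max]]; have [a1] := directed_inhabited dD.
have exP : exists k, `[< exists a, H (r a) = k >].
  by exists (H (r a1)); apply/asboolP; exists a1.
case: (ex_minnP exP) => _ /asboolP[a <-] a_min.
have {}a_min b : (H (r a) <= H (r b))%N.
  by apply: a_min; apply/asboolP; exists b.
exists a => b ab; apply/eqP.
rewrite eqn_leq andbC central_rank_le /=; last first.
  by apply: r_lb; exists b.
(* Here the meet of [r a] with [u] is itself a lower bound of the net, because it is the component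
   of every later term. *)
suff ax : r a `&` u <= x.
  apply: (leq_trans (central_rank_le (r_decr _ _ ab))).
  by have := central_rank_le ax; rewrite /H -!meetA !meetxx.
apply: r_max => _ [c _ <-].
have [e [ce ae]] := directed_ub dD c a.
rewrite -(central_rank_meet_eq (r_decr _ _ ae)) //.
exact: le_trans (leIl _ _) (r_decr _ _ ce).
Qed.

Local Open Scope ring_scope.

Lemma central_rank_state :
  exists w : E -> R, [/\ is_state w, o_continuous w & subadditive_state w].
Proof.
have u0 : 0 < (h u)%:R :> R by rewrite ltr0n (rank_gt0 hP).
exists (fun x => (H x)%:R / (h u)%:R); split.
- split=> [x|||x y z /central_rank_osum ->].
  + rewrite divr_ge0 //= ler_pdivrMr // mul1r ler_nat -central_rank1.
    by rewrite central_rank_le ?ea_lex1.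
  + by rewrite central_rank0 mul0r.
  + by rewrite central_rank1 divff // gt_eqF.
  + by rewrite natrD mulrDl.
(* The net of values is eventually equal to its limit, so it is enough that the limit lies in
   [A]. *)
- move=> D leD dD v x [l [r [lx rx lvr]]] A /nbhs_singleton Ax.
  have [a aP] := central_rank_net_up dD lx.
  have [b bP] := central_rank_net_down dD rx.
  have [c [ac bc]] := directed_ub dD a b.
  exists c => // e ce /=.
  suff -> : H (v e) = H x by [].
  have [le re] := lvr e.
  (* The rank of [v e] is squeezed between those of [l e] and [r e], both equal to that of [x]. *)
  apply/eqP; rewrite eqn_leq -{1}(bP e (directed_trans dD bc ce)).
  by rewrite -(aP e (directed_trans dD ac ce)) !central_rank_le.
- move=> x y; rewrite -mulrDl -natrD ler_pM2r ?invr_gt0 // ler_nat.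
  exact: central_rank_join.
Qed.

End RankState.
End CentralElement.

(** * Multiples of an atom and the other atoms *)

Section AtomMultiples.
Context {d : Order.disp_t} {E : latticeEffectAlgebraType d}.
Implicit Types a c r t u x y z : E.

Lemma ea_mulSP n a x : ea_mul n.+1 a = Some x <->
  exists2 y, ea_mul n a = Some y & osum a y = Some x.
Proof.
rewrite /ea_mul iterS; case: (iter n _ _) => [y|] /=; last first.
  by split=> [//|[y]].
by split=> [ay|[z [<-]]//]; exists y.
Qed.

Lemma ea_mulD n m a x y z : ea_mul n a = Some x -> ea_mul m a = Some y ->
  osum x y = Some z -> ea_mul (n + m) a = Some z.
Proof.
elim: n x z => [|n IHn] x z.
  by case=> <- my; rewrite osum0l => -[<-].
move=> /ea_mulSP[v nv av] my xy; have [r vy ar] := osumA_r av xy.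
by apply/ea_mulSP; exists r => //; apply: IHn nv my vy.
Qed.

Lemma ea_mul_inj n m a x : a <> ea0 -> ea_mul n a = Some x ->
  ea_mul m a = Some x -> n = m.
Proof.
move=> a0; elim: n m x => [|n IHn] [|m] x //.
- move=> -[<-] /ea_mulSP[y _ /le_osuml /ea_lex0] //.
- move=> + -[x0]; rewrite -x0 => /ea_mulSP[y _ /le_osuml /ea_lex0] //.
- move=> /ea_mulSP[y ny ay] /ea_mulSP[z mz az].
  by rewrite (IHn m y) // (osum_inj ay az).
Qed.

Lemma ea_mul_le n m a x y : (n <= m)%N -> ea_mul n a = Some x ->
  ea_mul m a = Some y -> x <= y.
Proof.
elim: m y => [|m IHm] y; first by rewrite leqn0 => /eqP -> [<-] [<-].
rewrite leq_eqVlt => /orP[/eqP -> -> [->] //|nm nx /ea_mulSP[z mz az]].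
exact: le_trans (IHm z nm nx mz) (le_osumr az).
Qed.

(** Distinct atoms are disjoint, so removing one copy of [a] from [t] keeps [c] below the rest. *)
Lemma atom_le_subatom a c r t : ea_atom a -> ea_atom c -> c <> a -> osum c a ->
  c <= t -> osum a r = Some t -> c <= r.
Proof.
move=> a_atom c_atom ca /osum_orthoP ca' ct ar.
apply: (le_osubl _ ca' ct (le_osuml ar) ar).
by apply: atom_meet => // /(atom_le_atom c_atom a_atom).
Qed.

Lemma atom_nle_mul n a c t : ea_atom a -> ea_atom c -> c <> a -> osum c a ->
  ea_mul n a = Some t -> ~ (c <= t).
Proof.
move=> a_atom c_atom ca co; elim: n t => [|n IHn] t.
  by case: c_atom => c0 _ [<-] /ea_lex0.
move=> /ea_mulSP[y /IHn cy ay] ct; apply: cy.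
exact: atom_le_subatom a_atom c_atom ca co ct ay.
Qed.

Lemma atom_le_ortho_mul n a c t : ea_atom a -> ea_atom c -> c <> a ->
  osum c a -> ea_mul n a = Some t -> c <= ortho t.
Proof.
move=> a_atom c_atom ca co; elim: n t => [|n IHn] t.
  by case=> <-; rewrite ortho0 ea_lex1.
move=> /ea_mulSP[y /IHn cy ay]; rewrite osumC in ay.
have [r ar yr] := osumA_r ay (osum_orthor t).
(* From t = y + a one gets y' = a + t', so one copy of [a] can be removed from y'. *)
rewrite -(orthoP yr) in ar.
exact: atom_le_subatom a_atom c_atom ca co cy ar.
Qed.

End AtomMultiples.

(** * The element [u] and its rank function in the two cases *)

Section NonsharpAtom.
Context {d : Order.disp_t} {E : latticeEffectAlgebraType d}.
Context (E_atomic : ea_atomic E).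
Implicit Types a b c t u x y z : E.

Lemma chain_rank a : ea_archimedean E -> ea_atom a ->
  (forall c, ea_atom c -> osum c a) ->
  exists u h, [/\ sharp u, rank_function u h &
    forall c, ea_atom c -> c <= u \/ c <= ortho u].
Proof.
move=> E_arch a_atom a_ortho; have [a0 _] := a_atom.
have [n [n0 + n_max]] := E_arch a a0.
case nu: (ea_mul n a) => [u|//] _.
(* Everything below a multiple of [a] is a multiple of [a]: any atom below it must be [a], which is
   subtracted from both sides before inducting. *)
have le_mulE y m : ea_mul m a = Some y -> forall x, x <= y ->
    exists k, ea_mul k a = Some x.
  elim: m y => [|m IHm] y.
    by case=> <- x /ea_lex0 ->; exists 0%N.
  move=> my x xy; have [x0|x0] := pselect (x = ea0).
    by exists 0%N; rewrite x0.
  have [c c_atom cx] := E_atomic x0.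
  have [ca|ca] := pselect (c = a); last first.
    have := atom_nle_mul a_atom c_atom ca (a_ortho _ c_atom) my.
    by case; apply: le_trans xy.
  move: cx; rewrite ca => /le_osumP[x' ax'].
  move/ea_mulSP: my => [y' /IHm my' ay'].
  have [k kx'] := my' x' (le_osum2l ax' ay' xy).
  by exists k.+1; apply/ea_mulSP; exists x'.
pose lengths x := [set k | ea_mul k a = Some x]%classic.
(* The number of copies of [a] in [x], with default 0 for elements that are not multiples of [a]. *)
pose h x := xget 0%N (lengths x).
have hE x : x <= u -> ea_mul (h x) a = Some x.
  move=> /(le_mulE _ _ nu)[k kx].
  by apply: (@xgetPex _ _ (lengths x)); exists k.
have h_uniq k x : ea_mul k a = Some x -> h x = k.
  move=> kx; apply: (ea_mul_inj a0 _ kx).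
  by apply: (@xgetPex _ _ (lengths x)); exists k.
exists u, h; split.
(* An atom below [u] is [a]; if it were also below u', the multiple (n+1) a would exist, against the
   maximality of [n]. *)
- apply: contrapT => /E_atomic[c c_atom]; rewrite lexI => /andP[cu cu'].
  have [ca|ca] := pselect (c = a); last first.
    exact: (atom_nle_mul a_atom c_atom ca (a_ortho _ c_atom) nu cu).
  have [t at_] : exists t, osum a u = Some t by apply: osum_some; rewrite -ca.
  have /n_max : ea_mul n.+1 a by rewrite /ea_mul iterS -/(ea_mul n a) nu /= at_.
  by rewrite ltnn.
- split.
  + by rewrite (h_uniq n).
  + move=> x y z zu xy; apply: h_uniq.
    by apply: (ea_mulD _ _ xy); apply: hE; apply: le_trans zu;
      [apply: le_osuml xy | apply: le_osumr xy].
  + by move=> x /hE + hx; rewrite hx => -[].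
  + move=> x y /hE hx /hE hy.
    have [xy|/ltnW yx] := leqP (h x) (h y).
      by rewrite (join_r (ea_mul_le xy hx hy)) leq_addl.
    by rewrite (join_l (ea_mul_le yx hy hx)) leq_addr.
- move=> c c_atom; have [->|ca] := pselect (c = a).
    by left; apply: (ea_mul_le n0 _ nu); rewrite /ea_mul /= osum0r.
  by right; apply: atom_le_ortho_mul a_atom c_atom ca (a_ortho _ c_atom) nu.
Qed.

(** As a <= a' and b /\ a' = 0, modularity gives u /\ a' = a for u = a \/ b. Dually u' \/ a = a', a
    disjoint join and hence a sum, so a + a = u. Finally u /\ u' lies below [a] and below b', which
    are disjoint. *)
Lemma nonortho_join a b : ea_modular E -> ea_atom a -> osum a a ->
  ea_atom b -> ~ osum b a ->
  osum a a = Some (a `|` b) /\ sharp (a `|` b).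
Proof.
move=> E_mod a_atom /osum_orthoP aa b_atom nba.
have ba' : b `&` ortho a = ea0 by apply: atom_meet => // /osum_orthoP.
have ab' : a `&` ortho b = ea0.
  by apply: atom_meet => // /le_ortho_sym /osum_orthoP.
have uE : (a `|` b) `&` ortho a = a.
  by rewrite -E_mod // ba' (join_l (ea_le0x _)).
set u := a `|` b in uE *.
have ua' : ortho u <= ortho a by rewrite le_ortho ?leUl.
have ub' : ortho u <= ortho b by rewrite le_ortho ?leUr.
have [t u't] := osum_some ua'.
have tE : t = ortho a.
  rewrite (osum_join u't).
    by rewrite -[in RHS]uE ortho_meet orthoK.
  by apply: ea_lex0; rewrite -ab' lexI leIr (le_trans (leIl _ _) ub').
split.
  rewrite tE osumC in u't.
  have [v av vu] := osumA_l u't (osum_orthor a).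
  by rewrite av -(orthoK v) (orthoP vu) orthoK.
apply: ea_lex0; rewrite -[leRHS]ab' lexI (le_trans (leIr _ _) ub') andbT.
by rewrite -[leRHS]uE lexI leIl (le_trans (leIr _ _) ua').
Qed.

Lemma height2_rank a b : ea_modular E -> ea_atom a -> osum a a ->
  ea_atom b -> ~ osum b a ->
  exists u h, [/\ sharp u, rank_function u h &
    forall c, ea_atom c -> c <= u \/ c <= ortho u].
Proof.
move=> E_mod a_atom aa b_atom nba; have [a0 _] := a_atom.
have [] := nonortho_join E_mod a_atom aa b_atom nba.
set u := a `|` b => aau u_sharp.
(* The sum a + a does not mention [b], so every atom not orthogonal to [a] gives the same join
   [u]. *)
have u_join c : ea_atom c -> ~ osum c a -> u = c `|` a.
  move=> c_atom nca.
  have [] := nonortho_join E_mod a_atom aa c_atom nca.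
  by rewrite aau joinC => -[].
have u0 : u <> ea0 by move=> u0; apply: a0; apply: ea_lex0; rewrite -u0 leUl.
have aa2 : ea_mul 2 a = Some u by rewrite /ea_mul /= osum0r /=.
have u_atoms c : ea_atom c -> c <= u \/ c <= ortho u.
  move=> c_atom; have [->|ca] := pselect (c = a).
    by left; rewrite leUl.
  have [co|nco] := pselect (osum c a); last first.
    by left; rewrite (u_join c) // leUl.
  by right; apply: atom_le_ortho_mul a_atom c_atom ca co aa2.
(* The interval [0, u] has height 2. If a <= x, the difference is below [a], hence 0 or [a]. *)
have u_cover x : x <= u -> x <> u -> x <> ea0 -> ea_atom x.
  move=> xu x_neq_u x_neq0; have [ax|nax] := pselect (a <= x).
    move/le_osumP: ax => [y ay].
    have ya : y <= a := le_osum2l ay aau xu.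
    have [y0|y0] := pselect (y = ea0).
      by move: ay; rewrite y0 osum0r => -[<-].
    case: a_atom => _ /(_ _ y0 ya) yE.
    by case: x_neq_u; move: ay; rewrite yE aau => -[].
  have [c c_atom cx] := E_atomic x_neq0.
  suff <- : c = x by [].
  have ca : c <> a by move=> ca; apply: nax; rewrite -ca.
  have nco : ~ osum c a.
    move=> co; apply: (atom_nle_mul a_atom c_atom ca co aa2).
    exact: le_trans xu.
  (* Since a /\ x = 0 and c \/ a = u, modularity reads c = u /\ x = x. *)
  have := E_mod c a x cx.
  rewrite (atom_meet a_atom nax) -(u_join c) // (meet_idPr xu).
  by rewrite (join_l (ea_le0x _)).
pose h x : nat := if x == ea0 then 0 else if x == u then 2 else 1.
exists u, h; split=> //; split.
- by rewrite /h; case: eqP => // _; rewrite eqxx.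
- move=> x y z zu xy.
  have [x0|/eqP x0] := eqVneq x ea0.
    by move: xy; rewrite x0 osum0l /h eqxx => -[->].
  have [y0|/eqP y0] := eqVneq y ea0.
    by move: xy; rewrite y0 osum0r /h eqxx addn0 => -[->].
  (* If [u] were a summand of z <= u, the other summand would lie below u /\ u' = 0. *)
  have not_u v w : osum v w = Some z -> w <> ea0 -> v <> u.
    move=> + w0 vu; rewrite vu => uw; apply: w0; apply: ea_lex0.
    rewrite -[leRHS]u_sharp lexI (le_trans (le_osumr uw)) //=.
    by apply: le_ortho_sym; apply/osum_orthoP; rewrite uw.
  have yx : osum y x = Some z by rewrite osumC.
  have xu := not_u _ _ xy y0; have yu := not_u _ _ yx x0.
  (* Otherwise [z] is an atom, so x = z and y = 0. Two nonzero summands therefore give 1 + 1 = 2. *)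
  have zE : z = u.
    apply: contrapT => z_neq_u.
    have z0 : z <> ea0.
      by move=> z0; apply: x0; apply: ea_lex0; rewrite -z0 (le_osuml xy).
    have [_ z_min] := u_cover _ zu z_neq_u z0.
    apply: y0; apply: (osum_inj xy).
    by rewrite osum0r; congr Some; apply: z_min => //; apply: le_osuml xy.
  rewrite zE /h eqxx; case: eqP => // _; case: eqP => // _; case: eqP => // _.
  by case: eqP => // _; case: eqP.
- by move=> x _; rewrite /h; case: eqP => // _; case: eqP.
- move=> x y xu yu.
  have [->|x0] := eqVneq x ea0.
    by rewrite (join_r (ea_le0x _)) leq_addl.
  have [->|y0] := eqVneq y ea0.
    by rewrite (join_l (ea_le0x _)) leq_addr.
  have h_le2 v : (h v <= 2)%N by rewrite /h; case: eqP => // _; case: eqP.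
  apply: leq_trans (h_le2 _) _.
  have h_ge1 v : v != ea0 -> (1 <= h v)%N.
    by rewrite /h; case: eqP => // _ _; case: eqP.
  exact: (leq_add (h_ge1 _ x0) (h_ge1 _ y0)).
Qed.

End NonsharpAtom.

Theorem corollary5 (R : realType) (d : Order.disp_t)
    (E : latticeEffectAlgebraType d)
    (E_modular : ea_modular E)
    (E_archimedean : ea_archimedean E)
    (E_atomic : ea_atomic E)
    (E_not_sharp : @sharp d E <> setT) :
  exists w : E -> R, [/\ is_state w, o_continuous w & subadditive_state w].
Proof.
have [x xx0] : exists x : E, x `&` ortho x <> ea0.
  apply: contrapT => nx; apply: E_not_sharp; apply/seteqP; split=> // x _.
  by apply: contrapT => xx0; apply: nx; exists x.
have [a a_atom] := E_atomic _ xx0; rewrite lexI => /andP[ax ax'].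
(* From a <= x follows x' <= a', so a <= x' <= a'. *)
have aa : osum a a by apply/osum_orthoP/(le_trans ax')/le_ortho.
suff [u [h [u_sharp hP u_atoms]]] : exists u h, [/\ sharp u, rank_function u h &
    forall c : E, ea_atom c -> c <= u \/ c <= ortho u].
  exact (central_rank_state E_atomic u_sharp u_atoms R hP).
have [a_ortho|] := pselect (forall c : E, ea_atom c -> osum c a).
  exact (chain_rank E_atomic E_archimedean a_atom a_ortho).
move=> /existsNP[b /not_implyP[b_atom nba]].
exact (height2_rank E_atomic E_modular a_atom aa b_atom nba).
Qed.
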